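(* Let $E\in\mathbb R^{k\times N}$ be a nonzero matrix, $A\in\mathbb R^{m\times N}$, $y\in\mathbb R^m$, $C\in\mathbb R^{p\times N}$, $d\in\mathbb R^p$. Let $x^*$ be a feasible point of the problem $$\min_{x\in\mathbb R^N}\|Ex\|_1\quad\text{subject to}\quad Ax=y,\ \ Cx\ge d,$$ and let $\alpha$, $\mathcal S$, $b$ be as defined in the context. Then $x^*$ is the unique minimizer of this problem if and only if the following conditions hold: (a) the matrix $\begin{bmatrix}A\\ C_{\alpha\bullet}\\ E_{\mathcal S^c\bullet}\end{bmatrix}$ has full column rank; and (b) there exist $u\in\mathbb R^m$, $u'\in\mathbb R^{|\alpha|}_{++}$, and $u''\in\mathbb R^{|\mathcal S^c|}$ with $\|u''\|_\infty<1$ such that $A^Tu+C_{\alpha\bullet}^Tu'-E_{\mathcal S^c\bullet}^Tu''=b$.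
   Context: Vector inequalities are componentwise; $\mathbb R^n_{++}$ is the set of vectors with strictly positive entries. For a matrix $M$ and row index set $\beta$, $M_{\beta\bullet}$ is the submatrix of rows indexed by $\beta$. Given $x^*$: $\alpha:=\{i\in\{1,\ldots,p\}\mid(Cx^*-d)_i=0\}$; $\mathcal S:=\{i\in\{1,\ldots,k\}\mid(Ex^* )_i\ne0\}$ with complement $\mathcal S^c$ in $\{1,\ldots,k\}$; $\widehat b:=\mathrm{sgn}((Ex^* )_{\mathcal S})\in\{\pm1\}^{|\mathcal S|}$ (componentwise sign) and $b:=E_{\mathcal S\bullet}^T\widehat b\in\mathbb R^N$ (so $b=0$ if $\mathcal S=\emptyset$). *)

(* Defs.v *)
From mathcomp Require Import all_boot all_order all_algebra.
From mathcomp Require Import all_reals normedtype.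
Set Implicit Arguments.
Unset Strict Implicit.
Unset Printing Implicit Defensive.
Import Order.TTheory GRing.Theory Num.Theory.
Local Open Scope ring_scope.

Section Defs.
Context {R : realType}.

(* The sup norm needs no counterpart here: `|v| on 'cV[R]_n is the library's
   mx_norm, the largest modulus of an entry (0 when n = 0). *)
Definition l1norm n (v : 'cV[R]_n) : R := \sum_(i < n) `|v i 0|.

Definition vec_ge n (v w : 'cV[R]_n) : Prop := forall i, w i 0 <= v i 0.

Definition vec_pos n (v : 'cV[R]_n) : Prop := forall i, 0 < v i 0.

(* Rows are kept in the order of enum_val, i.e. by increasing index. *)
Definition rows m n (B : {set 'I_m}) (M : 'M[R]_(m, n)) : 'M[R]_(#|B|, n) :=
  rowsub (fun i : 'I_#|B| => enum_val i) M.

Definition full_column_rank m n (M : 'M[R]_(m, n)) : Prop := \rank M = n.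

Section Problem.
Context {k m p N : nat}.
Implicit Types (E : 'M[R]_(k, N)) (A : 'M[R]_(m, N)) (y : 'cV[R]_m).
Implicit Types (C : 'M[R]_(p, N)) (d : 'cV[R]_p) (x : 'cV[R]_N).

Definition feasible A y C d x : Prop := A *m x = y /\ vec_ge (C *m x) d.

Definition minimizer E A y C d x : Prop :=
  feasible A y C d x /\
  forall z, feasible A y C d z -> l1norm (E *m x) <= l1norm (E *m z).

Definition unique_minimizer E A y C d x : Prop :=
  minimizer E A y C d x /\ forall z, minimizer E A y C d z -> z = x.

Definition active C d x : {set 'I_p} := [set i | (C *m x - d) i 0 == 0].

Definition esupp E x : {set 'I_k} := [set i | (E *m x) i 0 != 0].

Definition bhat E x : 'cV[R]_#|esupp E x| :=
  map_mx Num.sg (rows (esupp E x) (E *m x)).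

Definition bvec E x : 'cV[R]_N := (rows (esupp E x) E)^T *m bhat E x.

End Problem.
End Defs.

(* Main.v *)
(* Write D h for the directional derivative at xs of x |-> |E x|_1, that is
   b^T h + |E_{S^c} h|_1.  The problem is polyhedral, so xs is the unique minimizer
   iff D h > 0 for every h <> 0 with A h = 0 and C_alpha h >= 0; this is condition
   (a) together with the strict dual certificate (b), by Stiemke's theorem of the
   alternative. *)
Require Import Defs.
From mathcomp Require Import all_boot all_order all_algebra.
From mathcomp Require Import all_reals normedtype.
From mathcomp Require Import lra.
From mathcomp Require boolp.
Import Order.TTheory GRing.Theory Num.Theory.
Local Open Scope ring_scope.

(** * Theorems of the alternative for linear systems *)

Lemma vec_ge0E {R : realType} {n : nat} (v : 'cV[R]_n) :
  vec_ge v 0 <-> forall i, 0 <= v i 0.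
Proof. by split=> h i; have := h i; rewrite mxE. Qed.

Lemma vec_ge0_col_mx {R : realType} {m n : nat} (u : 'cV[R]_m) (v : 'cV[R]_n) :
  vec_ge (col_mx u v) 0 <-> vec_ge u 0 /\ vec_ge v 0.
Proof.
rewrite !vec_ge0E; split=> [h|[hu hv] i].
  by split=> i; [have := h (lshift n i)|have := h (rshift m i)];
    rewrite ?col_mxEu ?col_mxEd.
by case: (split_ordP i) => j ->; rewrite ?col_mxEu ?col_mxEd.
Qed.

(* Bartl's algebraic induction on the rows: if the last m rows do not suffice,
   some z0 has a z0 = -1 for the first row a and pairs to >= 0 with the others
   and to < 0 with c; projecting along z0 onto the kernel of a removes a. *)
Lemma farkas {R : realType} {m n : nat} (M : 'M[R]_(m, n)) (c : 'rV[R]_n) :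
  (forall z : 'cV[R]_n, vec_ge (M *m z) 0 -> 0 <= (c *m z) 0 0) ->
  exists2 l : 'rV[R]_m, (forall j, 0 <= l 0 j) & c = l *m M.
Proof.
elim: m M c => [|m IHm] M c hc.
  (* With no rows the premise on [z] is vacuous, so [c] is nonnegative on each unit vector and on
     its opposite. *)
  exists 0 => [[]//|]; rewrite mul0mx; apply/rowP => j; apply/eqP.
  have c_ge0 (z : 'cV_n) : 0 <= (c *m z) 0 0 by apply: hc => -[].
  have := c_ge0 (delta_mx j 0); have := c_ge0 (- delta_mx j 0).
  by rewrite mulmxN -colE !mxE eq_le oppr_ge0 => -> ->.
rewrite -[m.+1]/(1 + m)%N in M hc *.
rewrite -[M]vsubmxK in hc *; move: (usubmx M) (dsubmx M) hc => a B hc {M}.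
have [h|] := boolp.pselect (forall z, vec_ge (B *m z) 0 -> 0 <= (c *m z) 0 0).
  have [l l_ge0 ->] := IHm _ _ h; exists (row_mx 0 l) => [j|].
    by case: (split_ordP j) => i ->; rewrite ?row_mxEl ?row_mxEr ?mxE.
  by rewrite mul_row_col mul0mx add0r.
move/boolp.existsNP => [z1 /boolp.not_implyP[Bz1 /negP]]; rewrite -ltNge => cz1.
have az1 : (a *m z1) 0 0 < 0.
  rewrite ltNge; apply/negP => az1; move: cz1; apply/negP; rewrite -leNgt.
  apply: hc; rewrite mul_col_mx; apply/vec_ge0_col_mx; split=> // i.
  by rewrite !ord1 mxE.
pose s := - ((a *m z1) 0 0)^-1; pose z0 := s *: z1.
have s_gt0 : 0 < s by rewrite oppr_gt0 invr_lt0.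
have az0 : a *m z0 = (-1)%:M.
  apply/rowP => i; rewrite !ord1 -scalemxAr [LHS]mxE [RHS]mxE eqxx mulr1n.
  by rewrite mulNr mulVf // lt_eqF.
have Bz0 i : 0 <= (B *m z0) i 0.
  by rewrite -scalemxAr mxE mulr_ge0 ?(ltW s_gt0) //; move/vec_ge0E: Bz1.
have cz0 : (c *m z0) 0 0 < 0.
  by rewrite -scalemxAr mxE pmulr_rlt0.
have [z Bz|l l_ge0 defc] := IHm (B + B *m z0 *m a) (c + c *m z0 *m a).
  have e p (D : 'M_(p, n)) :
      (D + D *m z0 *m a) *m z = D *m (z + z0 *m (a *m z)).
    by rewrite mulmxDl mulmxDr !mulmxA.
  rewrite e; rewrite e in Bz; apply: hc.
  rewrite mul_col_mx; apply/vec_ge0_col_mx; split=> // i.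
  rewrite mulmxDr (mulmxA a z0) az0 mul_scalar_mx scaleN1r subrr.
  exact: lexx.
(* Solving [c + c z0 a = l (B + B z0 a)] for [c] gives this coefficient of [a]; it is nonnegative
   since [l] and [B z0] are, while [c z0] is negative. *)
exists (row_mx (l *m (B *m z0) - c *m z0) l) => [j|].
  case: (split_ordP j) => i ->; rewrite ?row_mxEl ?row_mxEr //.
  rewrite !ord1 mxE addr_ge0 //.
    by rewrite mxE sumr_ge0 // => q _; rewrite mulr_ge0.
  by rewrite mxE oppr_ge0 ltW.
apply: (addIr (c *m z0 *m a)); rewrite defc mul_row_col mulmxDr mulmxBl !mulmxA.
by rewrite addrAC subrK addrC.
Qed.

(** By hypothesis each [- row i M] satisfies the premise of [farkas], whence [f i >= 0] with
    [- row i M = f i *m M]. So [f i + delta_mx 0 i] annihilates [M], and summing over [i] makes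
    every entry positive. *)
Lemma stiemke {R : realType} {m n : nat} (M : 'M[R]_(m, n)) :
  (forall z : 'cV[R]_n, vec_ge (M *m z) 0 -> M *m z = 0) ->
  exists2 l : 'rV[R]_m, (forall j, 0 < l 0 j) & l *m M = 0.
Proof.
move=> hM.
have /boolp.choice[f hf] (i : 'I_m) :
    exists l : 'rV[R]_m, (forall j, 0 <= l 0 j) /\ - row i M = l *m M.
  have [|l l0 e] := @farkas _ _ _ M (- row i M); last by exists l.
  by move=> z /hM Mz; rewrite mulNmx -row_mul Mz row0 oppr0 mxE.
exists (\sum_i (f i + delta_mx 0 i)) => [j|].
  rewrite summxE (bigD1 j) //= ltr_wpDr //.
    apply: sumr_ge0 => i _; rewrite !mxE addr_ge0 ?ler0n //.
    by case: (hf i).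
  by rewrite !mxE !eqxx ltr_wpDl //; case: (hf j).
rewrite mulmx_suml big1 // => i _.
by rewrite mulmxDl -rowE; case: (hf i) => _ <-; rewrite addNr.
Qed.

(* An equality constraint A z = 0 is the pair A z >= 0, - A z >= 0, and u is the
   difference of the two multipliers. *)
Lemma stiemke_eq {R : realType} {q m n : nat} (A : 'M[R]_(q, n))
    (M : 'M[R]_(m, n)) :
  (forall z : 'cV[R]_n, A *m z = 0 -> vec_ge (M *m z) 0 -> M *m z = 0) ->
  exists (u : 'rV[R]_q) (l : 'rV[R]_m),
    (forall j, 0 < l 0 j) /\ u *m A + l *m M = 0.
Proof.
move=> hM; have [z|l] := @stiemke _ _ _ (col_mx A (col_mx (- A) M)).
  rewrite !mul_col_mx mulNmx => /vec_ge0_col_mx[Az /vec_ge0_col_mx[NAz Mz]].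
  have Az0 : A *m z = 0.
    apply/colP => i; rewrite [RHS]mxE; apply/eqP; rewrite eq_le.
    move/vec_ge0E/(_ i): NAz; rewrite mxE oppr_ge0 => ->.
    by move/vec_ge0E: Az => ->.
  by rewrite Az0 (hM z) // oppr0 !col_mx0.
rewrite -[l]hsubmxK -[rsubmx l]hsubmxK.
move: (lsubmx l) (lsubmx (rsubmx l)) (rsubmx (rsubmx l)) => {l} u v l l_gt0.
rewrite !mul_row_col mulmxN addrA -mulmxBl => e; exists (u - v), l; split=> // j.
by have := l_gt0 (rshift _ (rshift _ j)); rewrite !row_mxEr.
Qed.

(** * Full column rank, the sup norm and the dual certificate *)

Lemma full_column_rankP {R : realType} {m n : nat} (M : 'M[R]_(m, n)) :
  full_column_rank M <-> forall h : 'cV[R]_n, M *m h = 0 -> h = 0.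
Proof.
split=> [Mfull h|Minj].
  have MTfree : row_free M^T by rewrite /row_free mxrank_tr Mfull.
  move/(congr1 trmx); rewrite trmx_mul trmx0 => /eqP.
  by rewrite (mulmx_free_eq0 _ MTfree) => /eqP /(congr1 trmx); rewrite trmxK trmx0.
rewrite /full_column_rank -mxrank_tr; apply/eqP/inj_row_free => v.
move/(congr1 trmx); rewrite trmx_mul trmxK trmx0 => /Minj /(congr1 trmx).
by rewrite trmxK trmx0.
Qed.

Lemma mx_norm_lt1P {R : realType} {n : nat} (v : 'cV[R]_n) :
  `|v| < 1 <-> forall i, `|v i 0| < 1.
Proof.
have -> : `|v| = mx_norm v by []; rewrite mx_normrE; split=> [/bigmax_ltP[_ h] i|h].
  exact: (h (i, 0)).
(* The maximum starts from 0, hence the extra goal [0 < 1]. *)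
by apply/bigmax_ltP; split=> [|[i j] _]; [exact: ltr01|rewrite /= ord1].
Qed.

Lemma row_colE {R : realType} {n : nat} (u v : 'cV[R]_n) :
  (u^T *m v) 0 0 = \sum_i u i 0 * v i 0.
Proof. by rewrite mxE; apply: eq_bigr => i _; rewrite mxE. Qed.

(* Bounding |F h| by a slack vector t turns the hypothesis into one about the
   linear system A h = 0, C h >= 0, t + F h >= 0, t - F h >= 0,
   - b^T h - sum t >= 0, to which Stiemke's lemma applies.  After normalising the
   last multiplier to 1, the multipliers r, s of the two slack constraints satisfy
   r + s = 1, and u'' = s - r. *)
Lemma positive_multipliers {R : realType} {m p q n : nat} (A : 'M[R]_(m, n))
    (C : 'M[R]_(p, n)) (F : 'M[R]_(q, n)) (b : 'cV[R]_n) :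
  (forall h : 'cV[R]_n, A *m h = 0 -> vec_ge (C *m h) 0 ->
     (b^T *m h) 0 0 + l1norm (F *m h) <= 0 -> h = 0) ->
  exists (u : 'cV[R]_m) (u' : 'cV[R]_p) (u'' : 'cV[R]_q),
    [/\ vec_pos u', `|u''| < 1 & A^T *m u + C^T *m u' - F^T *m u'' = b].
Proof.
move=> hyp.
have [z|u [l []]] := @stiemke_eq _ _ _ _ (row_mx A (0 : 'M_(m, q)))
  (col_mx (row_mx C (0 : 'M_(p, q))) (col_mx (row_mx F 1%:M)
    (col_mx (row_mx (- F) 1%:M) (row_mx (- b^T) (const_mx (-1) : 'rV_q))))).
  rewrite -[z]vsubmxK; move: (usubmx z) (dsubmx z) => h t {z}.
  rewrite !mul_col_mx !mul_row_col !mul0mx !addr0 !mul1mx !mulNmx => Ah.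
  move=> /vec_ge0_col_mx[Ch /vec_ge0_col_mx[/vec_ge0E Fh
    /vec_ge0_col_mx[/vec_ge0E NFh /vec_ge0E/(_ 0)]]].
  have -> : (- (b^T *m h) + (const_mx (-1) : 'rV_q) *m t) 0 0 =
      - ((b^T *m h) 0 0 + \sum_i t i 0).
    rewrite opprD -sumrN !mxE; congr (_ + _).
    by apply: eq_bigr => i _; rewrite mxE mulN1r.
  rewrite oppr_ge0 => bt.
  have Ft i : `|(F *m h) i 0| <= t i 0.
    rewrite ler_norml; have := Fh i; have := NFh i.
    rewrite mxE [X in _ <= X + _]mxE [X in _ -> is_true (0 <= X) -> _]mxE.
    by move=> ? ?; apply/andP; split; lra.
  have h0 : h = 0.
    by apply: hyp => //; apply: le_trans bt; rewrite lerD2l ler_sum.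
  have t_ge0 i : 0 <= t i 0 by apply: le_trans (Ft i).
  have t0 : t = 0.
    apply/colP => i; rewrite mxE.
    apply: (psumr_eq0P (P := xpredT) (fun j _ => t_ge0 j)) isT.
    apply/eqP; rewrite eq_le sumr_ge0 // andbT.
    by move: bt; rewrite h0 mulmx0 mxE add0r.
  by rewrite h0 t0 !mulmx0 !oppr0 !addr0 !col_mx0.
rewrite -[l]hsubmxK -[rsubmx l]hsubmxK -[rsubmx (rsubmx l)]hsubmxK.
move: (lsubmx l) (lsubmx (rsubmx l)) (lsubmx (rsubmx (rsubmx l)))
  (rsubmx (rsubmx (rsubmx l))) => {l} v r s w l_gt0.
have v_gt0 j : 0 < v 0 j by have := l_gt0 (lshift _ j); rewrite row_mxEl.
have r_gt0 j : 0 < r 0 j.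
  by have := l_gt0 (rshift _ (lshift _ j)); rewrite row_mxEr row_mxEl.
have s_gt0 j : 0 < s 0 j.
  by have := l_gt0 (rshift _ (rshift _ (lshift _ j))); rewrite !row_mxEr row_mxEl.
have w_gt0 : 0 < w 0 0.
  by have := l_gt0 (rshift _ (rshift _ (rshift _ 0))); rewrite !row_mxEr.
(* The columns of [h] yield the equation for [b]; those of [t] yield [r + s = w] entrywise. *)
rewrite !mul_row_col !mul_mx_row !mulmx0 !mulmx1 !add_row_mx !add0r -row_mx0.
move=> /eq_row_mx[eb ers].
have {}eb : u *m A + (v *m C + (r - s) *m F) = w 0 0 *: b^T.
  apply/eqP; rewrite -subr_eq0 -eb [w]mx11_scalar !mxE mulr1n mul_scalar_mx.
  by rewrite mulmxBl mulmxN scalerN !addrA.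
have {}ers j : r 0 j + s 0 j = w 0 0.
  move/rowP/(_ j): ers; rewrite !mxE big_ord1 !mxE mulrN1 addrA => /eqP.
  by rewrite subr_eq0 => /eqP.
exists ((w 0 0)^-1 *: u^T), ((w 0 0)^-1 *: v^T), ((w 0 0)^-1 *: (s - r)^T).
split.
- by move=> i; rewrite !mxE mulr_gt0 ?invr_gt0.
- apply/mx_norm_lt1P => i; rewrite !mxE mulrC normrM normfV (gtr0_norm w_gt0).
  rewrite ltr_pdivrMr // mul1r -(ers i) ltr_norml.
  by have := r_gt0 i; have := s_gt0 i => ? ?; apply/andP; split; lra.
have {}eb : u *m A + v *m C - (s - r) *m F = w 0 0 *: b^T.
  by rewrite -eb -addrA -mulNmx opprB.
rewrite -!scalemxAr -scalerDr -scalerBr -!trmx_mul -linearD -linearB eb linearZ /=.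
by rewrite trmxK scalerA mulVf ?scale1r // gt_eqF.
Qed.

(** Pairing the certificate with [h] writes the last left-hand side as the sum of all [u'_i (C h)_i]
    and all [|(F h)_i| - u''_i (F h)_i]. These terms are nonnegative, so they all vanish; strictness
    of [u'] and [u''] then gives [C h = 0] and [F h = 0], and the rank condition gives [h = 0]. *)
Lemma sufficient_multipliers {R : realType} {m p q n : nat} (A : 'M[R]_(m, n))
    (C : 'M[R]_(p, n)) (F : 'M[R]_(q, n)) (b : 'cV[R]_n)
    (u : 'cV[R]_m) (u' : 'cV[R]_p) (u'' : 'cV[R]_q) (h : 'cV[R]_n) :
  full_column_rank (col_mx A (col_mx C F)) -> vec_pos u' -> `|u''| < 1 ->
  A^T *m u + C^T *m u' - F^T *m u'' = b ->
  A *m h = 0 -> vec_ge (C *m h) 0 ->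
  (b^T *m h) 0 0 + l1norm (F *m h) <= 0 -> h = 0.
Proof.
move=> /full_column_rankP full u'_gt0 /mx_norm_lt1P u''_lt1 <- Ah /vec_ge0E Ch.
have -> : (A^T *m u + C^T *m u' - F^T *m u'')^T *m h =
    u'^T *m (C *m h) - u''^T *m (F *m h).
  by rewrite !raddfB !raddfD /= !trmx_mul !trmxK mulmxBl mulmxDl -!mulmxA Ah
    mulmx0 add0r.
have Fh_ge i : `|u'' i 0| * `|(F *m h) i 0| <= `|(F *m h) i 0|.
  by rewrite ler_piMl // ltW.
have prod_ge0 i : 0 <= u' i 0 * (C *m h) i 0 by rewrite mulr_ge0 // ltW.
have slack_ge0 i : 0 <= `|(F *m h) i 0| - u'' i 0 * (F *m h) i 0.
  by rewrite subr_ge0 (le_trans (ler_norm _)) // normrM.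
rewrite mxE [X in _ + X + _]mxE !row_colE -addrA [- _ + _]addrC /l1norm -sumrB.
move=> le0.
have [sum1 sum2] : \sum_i u' i 0 * (C *m h) i 0 = 0 /\
    \sum_i (`|(F *m h) i 0| - u'' i 0 * (F *m h) i 0) = 0.
  have s1 : 0 <= \sum_i u' i 0 * (C *m h) i 0 by apply: sumr_ge0.
  have s2 : 0 <= \sum_i (`|(F *m h) i 0| - u'' i 0 * (F *m h) i 0).
    by apply: sumr_ge0.
  by split; lra.
apply: full; rewrite !mul_col_mx Ah.
have -> : C *m h = 0.
  apply/colP => i; rewrite [RHS]mxE; apply/eqP.
  have /eqP := psumr_eq0P (fun i _ => prod_ge0 i) sum1 (i := i) isT.
  by rewrite mulf_eq0 (gt_eqF (u'_gt0 i)).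
have -> : F *m h = 0; last by rewrite !col_mx0.
(* At a nonzero entry of [F h], [|u''_i| < 1] would make the second term positive. *)
apply/colP => i; rewrite [RHS]mxE; apply/eqP; apply: contraTT isT => Fhi.
have /eqP := psumr_eq0P (fun i _ => slack_ge0 i) sum2 (i := i) isT.
rewrite subr_eq0 => /eqP e.
have : `|u'' i 0| * `|(F *m h) i 0| < `|(F *m h) i 0|.
  by rewrite gtr_pMl ?normr_gt0.
by rewrite -normrM -e normr_id ltxx.
Qed.

(** * The directional derivative of the objective *)

Definition dirderiv {R : realType} {k N : nat} (E : 'M[R]_(k, N))
    (x h : 'cV[R]_N) : R :=
  ((bvec E x)^T *m h) 0 0 + l1norm (rows (~: esupp E x) E *m h).

(** Moves both parts to the full index set, for entrywise comparison with [l1norm]; the sign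
    vanishes off the support. *)
Lemma dirderivE {R : realType} {k N : nat} (E : 'M[R]_(k, N)) (x h : 'cV[R]_N) :
  dirderiv E x h = \sum_i (Num.sg ((E *m x) i 0) * (E *m h) i 0 +
    (if (E *m x) i 0 == 0 then `|(E *m h) i 0| else 0)).
Proof.
rewrite big_split /= /dirderiv; congr (_ + _).
  rewrite /bvec trmx_mul trmxK -mulmxA row_colE.
  pose F i := Num.sg ((E *m x) i 0) * (E *m h) i 0.
  rewrite (eq_bigr (fun j => F (enum_val j))) => [|j _]; last first.
    by rewrite /rows mul_rowsub_mx /bhat 2![in X in X * _ = _]mxE
      [in X in _ * X = _]mxE.
  rewrite -big_enum_val big_mkcond; apply: eq_bigr => i _; rewrite inE.
  by case: eqP => //= e; rewrite /F e sgr0 mul0r.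
rewrite /l1norm /rows mul_rowsub_mx.
rewrite (eq_bigr (fun j => `|(E *m h) (enum_val j) 0|)) => [|j _]; last first.
  by rewrite mxE.
rewrite -(big_enum_val (fun i => `|(E *m h) i 0|)) big_mkcond /=.
by apply: eq_bigr => i _; rewrite !inE negbK.
Qed.

(** Convexity: where [v] is nonzero, [|v| + sg v * w = sg v * (v + w) <= |v + w|]. *)
Lemma dirderiv_le {R : realType} {k N : nat} (E : 'M[R]_(k, N)) (x h : 'cV[R]_N) :
  l1norm (E *m x) + dirderiv E x h <= l1norm (E *m (x + h)).
Proof.
rewrite dirderivE /l1norm -big_split /= ler_sum // => i _.
rewrite mulmxDr [in X in _ <= X]mxE; set v := (E *m x) i 0; set w := (E *m h) i 0.
have [->|v0] := eqVneq v 0; first by rewrite normr0 sgr0 mul0r !add0r lexx.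
rewrite addr0 normrEsg -mulrDr (le_trans (ler_norm _)) //.
by rewrite normrM normr_sg v0 mul1r.
Qed.

(** The bound keeps nonzero entries of [E x] from changing sign, so the absolute value acts linearly
    on them. *)
Lemma dirderiv_eq {R : realType} {k N : nat} (E : 'M[R]_(k, N)) (x h : 'cV[R]_N) :
  (forall i, (E *m x) i 0 != 0 -> `|(E *m h) i 0| <= `|(E *m x) i 0|) ->
  l1norm (E *m (x + h)) = l1norm (E *m x) + dirderiv E x h.
Proof.
move=> small; rewrite dirderivE /l1norm -big_split /=; apply: eq_bigr => i _.
rewrite mulmxDr [in LHS]mxE; have := small i.
set v := (E *m x) i 0; set w := (E *m h) i 0.
have [->|v0 /(_ isT)] := eqVneq v 0; first by rewrite normr0 sgr0 mul0r !add0r.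
rewrite addr0; have [v_gt0|v_le0|v_eq0] := ltrgt0P v;
  last by rewrite v_eq0 eqxx in v0.
  rewrite (gtr0_sg v_gt0) mul1r ler_norml => /andP[? ?].
  by rewrite ger0_norm //; lra.
rewrite (ltr0_sg v_le0) mulN1r ler_norml => /andP[? ?].
by rewrite ler0_norm //; lra.
Qed.

Lemma dirderivZ {R : realType} {k N : nat} (E : 'M[R]_(k, N))
    (x h : 'cV[R]_N) (t : R) :
  0 <= t -> dirderiv E x (t *: h) = t * dirderiv E x h.
Proof.
move=> t_ge0; rewrite /dirderiv -!scalemxAr mxE mulrDr; congr (_ + _).
by rewrite /l1norm mulr_sumr; apply: eq_bigr => i _; rewrite mxE normrM ger0_norm.
Qed.

(** * Unique minimality in terms of feasible directions *)

Lemma small_scale {R : realType} {I : finType} (f g : I -> R) :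
  exists2 t, 0 < t & forall i, 0 < f i -> t * `|g i| <= f i.
Proof.
(* [s] dominates every ratio and the 1 keeps it positive; indices with [f i = 0] contribute 0, as
   division by zero gives 0. *)
pose s := 1 + \sum_i `|g i| / `|f i|.
have s_gt0 : 0 < s by rewrite ltr_pwDl // sumr_ge0 // => i _; rewrite divr_ge0.
exists s^-1 => [|i fi]; first by rewrite invr_gt0.
rewrite ler_pdivrMl // -ler_pdivrMr // /s (bigD1 i) //= (gtr0_norm fi).
rewrite addrCA lerDl addr_ge0 // sumr_ge0 // => j _; exact: divr_ge0.
Qed.

Lemma vec_ge0_rows {R : realType} {m n : nat} (B : {set 'I_m}) (M : 'M[R]_(m, n))
    (h : 'cV[R]_n) :
  vec_ge (rows B M *m h) 0 <-> forall i, i \in B -> 0 <= (M *m h) i 0.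
Proof.
rewrite vec_ge0E /rows mul_rowsub_mx; split=> [ge0 i iB|ge0 j].
  by have := ge0 (enum_rank_in iB i); rewrite mxE enum_rankK_in.
by rewrite mxE ge0 // enum_valP.
Qed.

Lemma unique_minimizerP {R : realType} {k m p N : nat} (E : 'M[R]_(k, N))
    (A : 'M[R]_(m, N)) (y : 'cV[R]_m) (C : 'M[R]_(p, N)) (d : 'cV[R]_p)
    (x : 'cV[R]_N) :
  feasible A y C d x ->
  unique_minimizer E A y C d x <->
  (forall h : 'cV[R]_N, A *m h = 0 -> vec_ge (rows (active C d x) C *m h) 0 ->
     dirderiv E x h <= 0 -> h = 0).
Proof.
move=> x_feas; have [Ax Cx] := x_feas.
have slackE i : (C *m x - d) i 0 = (C *m x) i 0 - d i 0.
  by rewrite mxE [X in _ + X]mxE.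
split=> [[[_ x_min] x_uniq] h Ah Ch Dh|hyp].
  (* [t1] preserves the signs of the nonzero entries of [E x], [t2] the inactive constraints. The
     step [t *: h] then gives a feasible point that is no worse, and uniqueness forces [h = 0]. *)
  have [t1 t1_gt0 ht1] :=
    small_scale (fun i => `|(E *m x) i 0|) (fun i => (E *m h) i 0).
  have [t2 t2_gt0 ht2] :=
    small_scale (fun i => (C *m x - d) i 0) (fun i => (C *m h) i 0).
  pose t := Num.min t1 t2.
  have t_gt0 : 0 < t by rewrite lt_min t1_gt0.
  have le_t1 : t <= t1 by rewrite ge_min lexx.
  have le_t2 : t <= t2 by rewrite ge_min lexx orbT.
  have z_feas : feasible A y C d (x + t *: h).
    split=> [|i]; first by rewrite mulmxDr -scalemxAr Ah scaler0 addr0.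
    rewrite mulmxDr -scalemxAr [X in _ <= X]mxE [X in _ <= _ + X]mxE.
    rewrite -lerBlDl -opprB lerNl -slackE.
    have [slack_gt0|slack_le0] := ltP 0 ((C *m x - d) i 0).
      apply: le_trans (ht2 i slack_gt0); rewrite -mulrN.
      apply: le_trans (ler_norm _) _; rewrite normrM normrN (gtr0_norm t_gt0).
      exact: ler_wpM2r.
    have slack0 : (C *m x - d) i 0 = 0.
      by apply/eqP; rewrite eq_le slack_le0 slackE subr_ge0 Cx.
    rewrite slack0 oppr_le0 mulr_ge0 ?(ltW t_gt0) //.
    by apply: (iffLR (vec_ge0_rows _ _ _) Ch); rewrite inE slack0.
  have z_le : l1norm (E *m (x + t *: h)) <= l1norm (E *m x).
    rewrite dirderiv_eq.
      by rewrite (dirderivZ _ _ _ _ (ltW t_gt0)) gerDl pmulr_rle0.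
    move=> i Exi; rewrite -scalemxAr mxE normrM (gtr0_norm t_gt0).
    by rewrite (le_trans (ler_wpM2r _ le_t1)) // ht1 // normr_gt0.
  have /x_uniq/eqP : minimizer E A y C d (x + t *: h).
    by split=> // z /x_min; apply: le_trans.
  rewrite -subr_eq0 addrAC subrr add0r scaler_eq0 (gt_eqF t_gt0) /=.
  by move/eqP.
have dirD z : feasible A y C d z -> A *m (z - x) = 0 /\
    vec_ge (rows (active C d x) C *m (z - x)) 0.
  move=> [Az Cz]; split; first by rewrite mulmxBr Az Ax subrr.
  apply/vec_ge0_rows => i; rewrite inE slackE subr_eq0 => /eqP Cxi.
  by rewrite mulmxBr mxE [X in _ + X]mxE Cxi subr_ge0.
(* By [dirderiv_le] the derivative along [z - x] is nonpositive. This claim yields uniqueness, and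
   also minimality, since a strictly better [z] would equal [x]. *)
have ge z : feasible A y C d z -> l1norm (E *m z) <= l1norm (E *m x) -> z = x.
  move=> /dirD[Az Cz] le; apply/eqP; rewrite -subr_eq0; apply/eqP/hyp => //.
  have := dirderiv_le E x (z - x); rewrite [x + _]addrC subrK; lra.
split=> [|z [z_feas /(_ _ x_feas)]]; last exact: ge.
split=> // z z_feas; rewrite leNgt; apply/negP => lt.
by move: (lt); rewrite (ge z z_feas (ltW lt)) ltxx.
Qed.

Theorem proposition4p1 (R : realType) (k m p N : nat)
    (E : 'M[R]_(k, N)) (A : 'M[R]_(m, N)) (y : 'cV[R]_m)
    (C : 'M[R]_(p, N)) (d : 'cV[R]_p) (xs : 'cV[R]_N)
    (E_neq0 : E <> 0) (xs_feasible : feasible A y C d xs) :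
  let alpha := active C d xs in
  let Sc := ~: esupp E xs in
  unique_minimizer E A y C d xs <->
  (full_column_rank (col_mx A (col_mx (rows alpha C) (rows Sc E))) /\
   exists (u : 'cV[R]_m) (u' : 'cV[R]_#|alpha|) (u'' : 'cV[R]_#|Sc|),
     [/\ vec_pos u', `|u''| < 1
       & A^T *m u + (rows alpha C)^T *m u' - (rows Sc E)^T *m u'' = bvec E xs]).
Proof.
move=> alpha Sc; rewrite unique_minimizerP //; split=> [hyp|].
  split; last exact: positive_multipliers.
  apply/full_column_rankP => h; rewrite !mul_col_mx => e.
  have [Ah Ch Eh] : [/\ A *m h = 0, rows alpha C *m h = 0 & rows Sc E *m h = 0].
    by move/eqP: e; rewrite !col_mx_eq0 => /and3P[/eqP ? /eqP ? /eqP ?].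
  (* All constraints being tight along h, the directional derivatives along h and
     - h are opposite, so one of them is nonpositive. *)
  have D z : rows Sc E *m z = 0 -> dirderiv E xs z = ((bvec E xs)^T *m z) 0 0.
    move=> z0; rewrite /dirderiv z0 /l1norm big1 ?addr0 // => i _.
    by rewrite mxE normr0.
  have [le0|/ltW ge0] := lerP (dirderiv E xs h) 0.
    by apply: hyp => //; rewrite Ch; apply/vec_ge0E => i; rewrite mxE.
  apply/eqP; rewrite -oppr_eq0; apply/eqP; apply: hyp.
  - by rewrite mulmxN Ah oppr0.
  - by rewrite mulmxN Ch oppr0; apply/vec_ge0E => i; rewrite mxE.
  by rewrite D mulmxN ?Eh ?oppr0 // mxE oppr_le0 -D.
move=> [full [u [u' [u'' [u'_gt0 u''_lt1 e]]]]] h.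
exact: sufficient_multipliers full u'_gt0 u''_lt1 e.
Qed.
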